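(* Let $K$ be a field equipped with a nonarchimedean valuation $\nu: K \to \mathbb{R}\cup\{\infty\}$ and an automorphic involution $a \mapsto \overline{a}$ of $K$ (possibly the identity) satisfying $\nu(\overline{a}) = \nu(a)$ for all $a \in K$. Let $A \in K^{n\times n}$ be Hermitian ($\overline{A} = A^T$) or skew-Hermitian ($\overline{A} = -A^T$). Then the function $p: \{0,1\}^n \to \mathbb{R}\cup\{\infty\}$ given by $p_S = \nu(A_S)$ is a valuated $\Delta$-matroid.
   Context: $\overline{A}$ denotes entrywise application of the involution. For $S \subseteq [n]$, $A_S$ denotes the determinant of the principal submatrix of $A$ with rows and columns indexed by $S$ (with $A_\emptyset = 1$), and $p_S := p(e_S)$ where $e_S = \sum_{i\in S} e_i$ is the indicator vector of $S$. For a function $p: \{0,1\}^n \to \mathbb{R}\cup\{\infty\}$, let $\operatorname{dom} p = \{x : p(x) \ne \infty\}$ and $P_p = \operatorname{conv}\{(x,p(x)) : x \in \operatorname{dom} p\} \subset \mathbb{R}^{n+1}$. The subdivision $\mathcal{S}_p$ induced by $p$ is the polytopal subdivision of $\operatorname{conv}\operatorname{dom} p$ consisting of the images, under the projection $\mathbb{R}^{n+1}\to\mathbb{R}^n$ deleting the last coordinate, of the lower faces of $P_p$ (faces supported by a hyperplane whose inner normal has positive last coordinate). The length of a segment with endpoints in $\{0,1\}^n$ is the Hamming distance between its endpoints. A $\Delta$-matroid polytope is a polytope with vertices in $\{0,1\}^n$ all of whose edges have length at most $2$ (equivalently, the convex hull of the indicator vectors of the bases of a $\Delta$-matroid). The function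 $p$ is a valuated $\Delta$-matroid if every cell of $\mathcal{S}_p$ is a $\Delta$-matroid polytope, equivalently every edge (1-dimensional cell) of $\mathcal{S}_p$ has length at most $2$. *)

(* Defs.v *)
From HB Require Import structures.
From mathcomp Require Import all_boot all_order all_algebra.
From mathcomp Require Import boolp classical_sets functions cardinality.
From mathcomp Require Import reals constructive_ereal.

Set Implicit Arguments.
Unset Strict Implicit.
Unset Printing Implicit Defensive.

Import Order.TTheory GRing.Theory Num.Theory.

Local Open Scope classical_set_scope.
Local Open Scope ring_scope.

(* The codomain R u {oo} is rendered as the extended reals \bar R without -oo. *)
Definition nonarch_valuation (K : fieldType) (R : realType)
    (nu : K -> \bar R) : Prop :=
  [/\ forall x, nu x <> -oo%E,
      forall x, nu x = +oo%E <-> x = 0,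
      forall x y, nu (x * y) = (nu x + nu y)%E
    & forall x y, (Order.min (nu x) (nu y) <= nu (x + y)%R)%E].

Definition is_hermitian (K : fieldType) (bar : K -> K) (n : nat)
    (A : 'M[K]_n) : Prop := map_mx bar A = A^T.

Definition is_skew_hermitian (K : fieldType) (bar : K -> K) (n : nat)
    (A : 'M[K]_n) : Prop := map_mx bar A = - A^T.

Definition principal_minor (K : fieldType) (n : nat) (A : 'M[K]_n)
    (S : {set 'I_n}) : K :=
  \det (mxsub (@enum_val _ (mem S)) (@enum_val _ (mem S)) A).

Definition dotrv (R : realType) (n : nat) (c x : 'rV[R]_n) : R :=
  \sum_(i < n) c ord0 i * x ord0 i.

Definition conv (R : realType) (n : nat) (X : set 'rV[R]_n) : set 'rV[R]_n :=
  [set x | exists (m : nat) (w : 'I_m -> R) (y : 'I_m -> 'rV[R]_n),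
    [/\ forall i, 0 <= w i, \sum_i w i = 1, forall i, X (y i)
      & x = \sum_i w i *: y i]].

Definition polytope (R : realType) (n : nat) (Q : set 'rV[R]_n) : Prop :=
  exists2 X : set 'rV[R]_n, finite_set X & Q = conv X.

(* The face of Q with inner normal c; c = 0 gives Q itself. *)
Definition face_of_normal (R : realType) (n : nat) (Q : set 'rV[R]_n)
    (c : 'rV[R]_n) : set 'rV[R]_n :=
  [set x | Q x /\ forall y, Q y -> dotrv c x <= dotrv c y].

Definition face (R : realType) (n : nat) (Q F : set 'rV[R]_n) : Prop :=
  exists c, F = face_of_normal Q c.

Definition vertex (R : realType) (n : nat) (Q : set 'rV[R]_n)
    (v : 'rV[R]_n) : Prop := face Q [set v].

Definition edge (R : realType) (n : nat) (Q : set 'rV[R]_n)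
    (u v : 'rV[R]_n) : Prop := u <> v /\ face Q (conv [set u; v]).

Definition hamming (R : realType) (n : nat) (u v : 'rV[R]_n) : nat :=
  #|[set i | u ord0 i != v ord0 i]%SET|.

(* {0,1}^n is identified with {set 'I_n}, the vector e_S corresponding to S. *)
Definition indicator (R : realType) (n : nat) (S : {set 'I_n}) : 'rV[R]_n :=
  \row_i (i \in S)%:R.

Definition delta_matroid_polytope (R : realType) (n : nat)
    (Q : set 'rV[R]_n) : Prop :=
  [/\ polytope Q,
      forall v, vertex Q v -> exists S : {set 'I_n}, v = indicator R S
    & forall u v, edge Q u v -> (hamming u v <= 2)%N].

Definition dom (R : realType) (n : nat) (p : {set 'I_n} -> \bar R) :
    set {set 'I_n} := [set S | p S <> +oo%E].

Definition lifted_polytope (R : realType) (n : nat)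
    (p : {set 'I_n} -> \bar R) : set 'rV[R]_(n + 1) :=
  conv [set row_mx (indicator R S) (fine (p S))%:M | S in dom p].

Definition lower_face (R : realType) (n : nat) (P F : set 'rV[R]_(n + 1)) :
    Prop :=
  exists2 c : 'rV[R]_(n + 1),
    0 < c ord0 (rshift n ord0) & F = face_of_normal P c.

Definition induced_subdivision (R : realType) (n : nat)
    (p : {set 'I_n} -> \bar R) : set (set 'rV[R]_n) :=
  [set lsubmx @` F | F in lower_face (lifted_polytope p)].

Definition valuated_delta_matroid (R : realType) (n : nat)
    (p : {set 'I_n} -> \bar R) : Prop :=
  (forall S, p S <> -oo%E) /\
  (forall C, induced_subdivision p C -> delta_matroid_polytope C).

(* Main.v *)
Require Import Defs.
From HB Require Import structures.
From mathcomp Require Import all_boot all_order all_algebra.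
From mathcomp Require Import boolp classical_sets functions cardinality.
From mathcomp Require Import reals constructive_ereal.
From mathcomp Require Import perm ring lra.

(** An edge of a cell of the subdivision singles out two sets S, T and a weight
    g such that [p U - g(U)] is minimal exactly at S and T. The principal pivot
    transform B of A at S satisfies [B_U = A_(S + U) / A_S] (symmetric
    difference), and being Hermitian up to signs it has [nu B_ij = nu B_ji].
    After pivoting, the two minimisers are the empty set and [S + T]; if the
    latter had at least three elements, strictness at the 1- and 2-element sets
    would bound every [nu B_ij] strictly below by half the weight of {i, j}, and
    the Leibniz formula would make the value at [S + T] strictly larger than
    the minimum. *)

Set Implicit Arguments.
Unset Strict Implicit.
Unset Printing Implicit Defensive.
Import Order.TTheory GRing.Theory Num.Theory.
Local Open Scope classical_set_scope.
Local Open Scope ring_scope.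

(** * Determinants, principal minors and the principal pivot transform *)

(** Sylvester's identity: both products in [e] equal the block matrix with rows [1, X] and [- Y, 1],
    and all their factors are block triangular. *)
Lemma det_1addmulmx (F : comNzRingType) m n (X : 'M[F]_(m, n)) (Y : 'M[F]_(n, m)) :
  \det (1%:M + X *m Y) = \det (1%:M + Y *m X).
Proof.
have e : block_mx 1%:M 0 (- Y) 1%:M *m block_mx 1%:M X 0 (1%:M + Y *m X) =
         block_mx (1%:M + X *m Y) X 0 1%:M *m block_mx 1%:M 0 (- Y) 1%:M.
  rewrite !mulmx_block !mulmx1 !mul1mx !mulmx0 !mul0mx !addr0 !add0r.
  by rewrite mulmxN mulNmx addrK addrC addrK.
have := congr1 (fun M => \det M) e.
by rewrite /= !det_mulmx !det_ublock !det_lblock !det1 !mul1r !mulr1.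
Qed.

Definition symdiff (T : finType) (A B : {set T}) : {set T} :=
  [set i | (i \in A) (+) (i \in B)]%SET.

Lemma symdiffK (T : finType) (A B : {set T}) : symdiff A (symdiff A B) = B.
Proof. by apply/setP => i; rewrite !inE addKb. Qed.

Lemma symdiff0 (T : finType) (A : {set T}) : symdiff A finset.set0 = A.
Proof. by apply/setP => i; rewrite !inE addbF. Qed.

(** Recentres a linear weight at [S]: toggling an element of [S] removes its weight, hence the
    change of sign. *)
Lemma sum_symdiff (V : zmodType) (I : finType) (g : I -> V) (S U : {set I}) :
  \sum_(i in symdiff S U) g i =
  \sum_(i in S) g i + \sum_(i in U) (if i \in S then - g i else g i).
Proof.
rewrite big_mkcond [X in X + _]big_mkcond [X in _ + X]big_mkcond -big_split /=.
apply: eq_bigr => i _; rewrite inE.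
by case: (i \in S); case: (i \in U); rewrite /= ?addrN ?addr0 ?add0r.
Qed.

Definition mix_cols (F : nzRingType) n (U : {set 'I_n}) (A B : 'M[F]_n) : 'M[F]_n :=
  \matrix_(i, j) if j \in U then A i j else B i j.

Lemma mulmx_mix_cols (F : nzRingType) n (U : {set 'I_n}) (C A B : 'M[F]_n) :
  C *m mix_cols U A B = mix_cols U (C *m A) (C *m B).
Proof.
apply/matrixP => i j; rewrite mxE [RHS]mxE; case: ifP => jU; rewrite mxE;
by apply: eq_bigr => k _; rewrite !mxE jU.
Qed.

Lemma mix_cols_symdiff (F : nzRingType) n (S U : {set 'I_n}) (A B : 'M[F]_n) :
  mix_cols U (mix_cols S B A) (mix_cols S A B) = mix_cols (symdiff S U) A B.
Proof. by apply/matrixP => i j; rewrite !mxE !inE; do 2 case: ifP. Qed.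

(** The matrix is the identity plus a product through dimension [#|U|]; Sylvester's identity swaps
    the factors and leaves the submatrix. Minors thus become determinants of size [n]. *)
Lemma det_mix_cols1 (F : fieldType) n (U : {set 'I_n}) (A : 'M[F]_n) :
  \det (mix_cols U A 1%:M) = principal_minor A U.
Proof.
rewrite /principal_minor; set f := enum_val.
have f_inj : injective f by apply: enum_val_inj.
(* [E] selects the rows [f k], and [E^T *m E] is the projection onto the coordinates in [U]. *)
pose E : 'M[F]_(#|U|, n) := \matrix_(k, j) (f k == j)%:R.
have EM p (M : 'M[F]_(n, p)) k j : (E *m M) k j = M (f k) j.
  rewrite mxE (bigD1 (f k)) //= mxE eqxx mul1r big1 ?addr0 // => l ne.
  by rewrite mxE eq_sym (negbTE ne) mul0r.
have ME p (M : 'M[F]_(p, n)) k j : (M *m E^T) k j = M k (f j).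
  rewrite mxE (bigD1 (f j)) //= !mxE eqxx mulr1 big1 ?addr0 // => l ne.
  by rewrite !mxE eq_sym (negbTE ne) mulr0.
have -> : mix_cols U A 1%:M = 1%:M + (A - 1%:M) *m E^T *m E.
  apply/matrixP => i j; rewrite !mxE.
  case: ifPn => jU.
    rewrite (bigD1 (enum_rank_in jU j)) //= ME !mxE /f enum_rankK_in // eqxx mulr1.
    rewrite big1 ?addr0 ?subrKC // => k ne; rewrite !mxE.
    case: eqP => [e|_]; last by rewrite mulr0.
    by case/eqP: ne; apply: f_inj; rewrite /f enum_rankK_in.
  rewrite big1 ?addr0 // => k _; rewrite !mxE.
  by case: eqP => [e|_]; [rewrite -e enum_valP in jU|rewrite mulr0].
rewrite det_1addmulmx; congr (\det _); apply/matrixP => k l.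
rewrite [LHS]mxE EM ME !mxE (inj_eq f_inj).
by rewrite subrKC.
Qed.

(** The size is a variable [m] so that [subst] can eliminate the equation, which the term [#|U|]
    would not allow. *)
Lemma det_mxsub_size1 (K : fieldType) n m (f : 'I_m -> 'I_n) (B : 'M[K]_n) : m = 1%N ->
  exists a, \det (mxsub f f B) = B (f a) (f a).
Proof. by move=> m1; subst m; exists 0; rewrite det_mx11 mxE. Qed.

Lemma det_mxsub_size2 (K : fieldType) n m (f : 'I_m -> 'I_n) (B : 'M[K]_n) : m = 2%N ->
  exists a b, a != b /\ \det (mxsub f f B) =
    B (f a) (f a) * B (f b) (f b) - B (f a) (f b) * B (f b) (f a).
Proof.
move=> m2; subst m; exists 0, 1; split=> //.
rewrite (expand_det_row _ 0) !big_ord_recl big_ord0 /cofactor !det_mx11 !mxE /=.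
rewrite expr0 expr1.
have -> : lift 0 0 = 1 :> 'I_2 by apply/val_inj.
have -> : lift 1 0 = 0 :> 'I_2 by apply/val_inj.
ring.
Qed.

Lemma principal_minor1 (K : fieldType) n (B : 'M[K]_n) i :
  principal_minor B [set i]%SET = B i i.
Proof.
have [a e] := det_mxsub_size1 (@enum_val _ (mem [set i]%SET)) B (cards1 i).
rewrite /principal_minor e.
by have := enum_valP a; rewrite inE => /eqP ->.
Qed.

Lemma principal_minor2 (K : fieldType) n (B : 'M[K]_n) i j : i != j ->
  principal_minor B [set i; j]%SET = B i i * B j j - B i j * B j i.
Proof.
move=> ij.
have c2 : #|[set i; j]%SET| = 2%N by rewrite cards2 ij.
have [a [b [ab e]]] := det_mxsub_size2 (@enum_val _ (mem [set i; j]%SET)) B c2.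
rewrite /principal_minor e.
move: ab; rewrite -(inj_eq enum_val_inj).
have := enum_valP a; have := enum_valP b; rewrite !inE.
case/orP=> /eqP-> /orP[] /eqP->; rewrite ?eqxx // => _; ring.
Qed.

Definition pivot (F : fieldType) n (S : {set 'I_n}) (A : 'M[F]_n) : 'M[F]_n :=
  invmx (mix_cols S A 1%:M) *m mix_cols S 1%:M A.

(** Left multiplication by [C = mix_cols S A 1%:M] sends [mix_cols U (pivot S A) 1%:M] to the matrix
    whose columns alternate once more between [A] and the identity, now according to
    [symdiff S U]. *)
Lemma principal_minor_pivot (F : fieldType) n (S U : {set 'I_n}) (A : 'M[F]_n) :
  principal_minor A S != 0 ->
  principal_minor A S * principal_minor (pivot S A) U =
  principal_minor A (symdiff S U).
Proof.
rewrite -!det_mix_cols1 => nz; rewrite -det_mulmx mulmx_mix_cols mulmx1.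
by rewrite mulKVmx ?unitmxE ?unitfE // mix_cols_symdiff.
Qed.

(* With E the diagonal projection onto S and E' = 1 - E, the matrices
   C = AE + E' and D = AE' + E satisfy C (sE - E') D^* = D (E - sE') C^*;
   the pivot is C^-1 D. *)
Lemma pivot_hermitian (F : fieldType) (bar : {rmorphism F -> F}) n
    (S : {set 'I_n}) (s : F) (A : 'M[F]_n) :
  principal_minor A S != 0 -> map_mx bar A = s *: A^T ->
  forall i j, (if i \in S then s else -1) * bar (pivot S A j i) =
              pivot S A i j * (if j \in S then 1 else - s).
Proof.
move=> nz hA.
have barA i j : bar (A i j) = s * A j i.
  by have /matrixP/(_ i j) := hA; rewrite !mxE.
set C := mix_cols S A 1%:M; set D := mix_cols S 1%:M A.
have uC : C \in unitmx by rewrite unitmxE unitfE det_mix_cols1.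
pose B := pivot S A; have CB : C *m B = D by rewrite mulKVmx.
pose J1 : 'M[F]_n := diag_mx (\row_i if i \in S then s else -1).
pose J2 : 'M[F]_n := diag_mx (\row_i if i \in S then 1 else - s).
pose star (M : 'M[F]_n) := (map_mx bar M)^T.
have starM M N : star (M *m N) = star N *m star M.
  by rewrite /star map_mxM trmx_mul.
have usC : star C \in unitmx.
  by rewrite unitmx_tr map_unitmx.
have key : C *m J1 *m star D = D *m J2 *m star C.
  apply/matrixP => i j; rewrite !mul_mx_diag !mxE.
  pose a := s * A i j.
  have L k : (\matrix_(i, j) (C i j * (\row_i if i \in S then s else -1) ord0 j)) i k
     * star D k j = (if k \in S then (k == j)%:R * a else - ((k == i)%:R * a)).
    rewrite !mxE; case: ifP => kS; rewrite ?rmorph_nat ?barA eq_sym.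
      case: eqP => [->|_]; rewrite /a ?mulr0 ?mul0r; ring.
    case: eqP => [->|_]; rewrite /a ?mul0r; ring.
  have Rk k : (\matrix_(i, j) (D i j * (\row_i if i \in S then 1 else - s) ord0 j)) i k
     * star C k j = (if k \in S then (k == i)%:R * a else - ((k == j)%:R * a)).
    rewrite !mxE; case: ifP => kS; rewrite ?rmorph_nat ?barA eq_sym.
      case: eqP => [->|_]; rewrite /a ?mul0r; ring.
    case: eqP => [->|_]; rewrite /a ?mulr0 ?mul0r; ring.
  under eq_bigr do rewrite L; under [RHS]eq_bigr do rewrite Rk.
  apply/eqP; rewrite -subr_eq0 -sumrB; apply/eqP.
  (* The difference of the two summands has the same form for [k] in [S] and outside; cancellation
     occurs only after summing over [k]. *)
  transitivity (\sum_k ((k == j)%:R * a - (k == i)%:R * a)).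
    by apply: eq_bigr => k _; case: ifP => _; ring.
  have sum_delta l : \sum_k (k == l)%:R = 1 :> F.
    by rewrite (bigD1 l) //= eqxx big1 ?addr0 // => k /negbTE ->.
  by rewrite sumrB -!mulr_suml !sum_delta subrr.
have : J1 *m star B = B *m J2.
  apply: (can_inj (mulmxK usC)); apply: (can_inj (mulKmx uC)).
  rewrite -[J1 *m _ *m _]mulmxA -(starM C B) CB !mulmxA key.
  by rewrite mulmxV ?mul1mx.
move=> /matrixP h i j; have := h i j.
by rewrite mul_diag_mx mul_mx_diag !mxE.
Qed.

(** * Valuations of determinants and of pivoted matrices *)

Section Valuation.
Context (R : realType) (K : fieldType) (nu : K -> \bar R).
Context (nuP : nonarch_valuation nu).

Lemma valuation0 : nu 0 = +oo%E.
Proof. by case: nuP => _ h _ _; apply/h. Qed.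

Lemma valuation_fin x : x != 0 -> exists r, nu x = r%:E.
Proof.
case: nuP => hN h0 _ _ x0; have := hN x; have := h0 x.
case: (nu x) => [r|[h _]|] //; first by exists r.
by rewrite h ?eqxx in x0.
Qed.

(** Twice the value of [e] is the value of 1, which is 0. This makes [nu] blind to all signs,
    including those of permutations. *)
Lemma valuation_sqr1 e : e * e = 1 -> nu e = 0%E.
Proof.
have nu1 : nu 1 = 0%E.
  case: nuP => _ _ /(_ 1 1) hM _.
  have [r er] := valuation_fin (oner_neq0 K).
  move: hM; rewrite mulr1 er -EFinD => -[] h; congr EFin; lra.
move=> e1; have e0 : e != 0.
  by apply/eqP => e0; move/eqP: e1; rewrite e0 mul0r eq_sym oner_eq0.
have [r er] := valuation_fin e0.
case: nuP => _ _ /(_ e e) hM _; move: hM.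
by rewrite e1 nu1 er -EFinD => -[] h; congr EFin; lra.
Qed.

Lemma valuation_sqr1M e x : e * e = 1 -> nu (e * x) = nu x.
Proof. by case: nuP => _ _ hM _ /valuation_sqr1; rewrite hM => ->; rewrite add0e. Qed.

Lemma valuationN x : nu (- x) = nu x.
Proof. by rewrite -mulN1r valuation_sqr1M // mulrNN mulr1. Qed.

Lemma lt_valuationD r x y :
  (r%:E < nu x)%E -> (r%:E < nu y)%E -> (r%:E < nu (x + y)%R)%E.
Proof.
case: nuP => _ _ _ hD hx hy; apply: lt_le_trans (hD x y).
by rewrite lt_min hx hy.
Qed.

Lemma lt_valuation_sum (I : finType) r (x : I -> K) :
  (forall i, (r%:E < nu (x i))%E) -> (r%:E < nu (\sum_i x i)%R)%E.
Proof.
move=> hx; elim/big_ind: _ => // [|y z]; last exact: lt_valuationD.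
by rewrite valuation0 ltry.
Qed.

Lemma lt_valuationM r s x y :
  (r%:E < nu x)%E -> (s%:E < nu y)%E -> ((r + s)%:E < nu (x * y)%R)%E.
Proof.
by case: nuP => _ _ -> _ hx hy; rewrite EFinD; apply: lteD.
Qed.

(** The number of factors is a successor because the strict bound fails for the empty product, of
    value 0. *)
Lemma lt_valuation_prod m (r : 'I_m.+1 -> R) (x : 'I_m.+1 -> K) :
  (forall i, ((r i)%:E < nu (x i))%E) ->
  ((\sum_i r i)%:E < nu (\prod_i x i)%R)%E.
Proof.
elim: m r x => [|m IH] r x hx; first by rewrite !big_ord1.
by rewrite !(big_ord_recl m.+1); apply: lt_valuationM => //; apply: IH => i.
Qed.

(** In each Leibniz term every index occurs once as a row and once as a column, so the half weights
    add up to the sum of [r]. *)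
Lemma lt_valuation_det m (r : 'I_m.+1 -> R) (B : 'M[K]_m.+1) :
  (forall i j, (((r i + r j) / 2)%:E < nu (B i j))%E) ->
  ((\sum_i r i)%:E < nu (\det B))%E.
Proof.
move=> hB; apply: lt_valuation_sum => /= s.
rewrite valuation_sqr1M -?expr2 ?sqrr_sign //.
have -> : \sum_i r i = \sum_i (r i + r (s i)) / 2.
  have : \sum_i r i = \sum_i r (s i) by apply: reindex_inj; apply: perm_inj.
  by rewrite -mulr_suml big_split /= => <-; lra.
exact: lt_valuation_prod.
Qed.

(** Singletons bound the diagonal; solving the 2 by 2 minor for [B i j * B j i] bounds that product,
    and symmetry of the values halves the bound. *)
Lemma lt_valuation_principal_minor n (B : 'M[K]_n) (g : 'I_n -> R) (T : {set 'I_n}) :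
  (2 < #|T|)%N -> (forall i j, nu (B i j) = nu (B j i)) ->
  (forall U : {set 'I_n}, U != finset.set0 -> U != T ->
     ((\sum_(i in U) g i)%:E < nu (principal_minor B U))%E) ->
  ((\sum_(i in T) g i)%:E < nu (principal_minor B T))%E.
Proof.
move=> T3 symB hU.
have neT (U : {set 'I_n}) : (#|U| <= 2)%N -> U != T.
  by move=> U2; apply: contraTneq T3 => <-; rewrite -leqNgt.
have h1 i : ((g i)%:E < nu (B i i))%E.
  have := hU [set i]%SET; rewrite big_set1 principal_minor1; apply.
    by rewrite -card_gt0 cards1.
  by apply: neT; rewrite cards1.
have h2 i j : (((g i + g j) / 2)%:E < nu (B i j))%E.
  have [->|ij] := eqVneq i j.
    by have -> : (g j + g j) / 2 = g j by lra.
  have : ((g i + g j)%:E < nu (B i j * B j i)%R)%E.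
    have -> : B i j * B j i = B i i * B j j - principal_minor B [set i; j]%SET.
      by rewrite principal_minor2 //; ring.
    apply: lt_valuationD; first exact: lt_valuationM.
    have := hU [set i; j]%SET; rewrite valuationN big_setU1 ?inE //= big_set1; apply.
      by rewrite -card_gt0 cards2.
    by apply: neT; rewrite cards2 ij.
  case: nuP => /(_ (B i j)) hN _ -> _; rewrite -(symB i j).
  case: (nu (B i j)) hN => [r _|_ _|] //; last by rewrite ltry.
  by rewrite -EFinD !lte_fin => ?; lra.
rewrite big_enum_val /=.
(* The strict determinant bound requires a positive size. *)
have [m em] : exists m, #|T| = m.+1 by case: #|T| T3 => // m _; exists m.
rewrite /principal_minor; move: (@enum_val _ (mem T)); rewrite em => f.
by apply: lt_valuation_det => i j; rewrite mxE.
Qed.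

(** Both cases are [map_mx bar A = s *: A^T] with [s] equal to 1 or -1, so every factor in
    [pivot_hermitian] squares to 1. *)
Lemma pivot_valuation_sym n (bar : {rmorphism K -> K}) (A : 'M[K]_n) S :
  (forall a, nu (bar a) = nu a) ->
  is_hermitian bar A \/ is_skew_hermitian bar A ->
  principal_minor A S != 0 ->
  forall i j, nu (pivot S A i j) = nu (pivot S A j i).
Proof.
move=> nubar hA nz i j.
have [s [ss hs]] : exists s : K, s * s = 1 /\ map_mx bar A = s *: A^T.
  case: hA => hA; first by exists 1; rewrite mulr1 scale1r.
  by exists (-1); rewrite mulrNN mulr1 scaleN1r.
have := congr1 nu (pivot_hermitian nz hs i j); rewrite [in RHS]mulrC.
rewrite !valuation_sqr1M ?nubar //.
  by case: ifP; rewrite ?mulr1 // mulrNN.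
by case: ifP; rewrite // mulrNN mulr1.
Qed.

(** Dividing by the minor at [S] cancels [k] and the weight of [S], so the pivoted minors are
    compared with a linear weight, negated on [S]. A large [symdiff S T] would turn the equality at
    [T] into a strict inequality. *)
Lemma two_minimal_minors n (bar : {rmorphism K -> K}) (A : 'M[K]_n)
    (g : 'I_n -> R) (k : R) (S T : {set 'I_n}) :
  (forall a, nu (bar a) = nu a) ->
  is_hermitian bar A \/ is_skew_hermitian bar A ->
  nu (principal_minor A S) = (k + \sum_(i in S) g i)%:E ->
  nu (principal_minor A T) = (k + \sum_(i in T) g i)%:E ->
  (forall U : {set 'I_n}, U != S -> U != T ->
    ((k + \sum_(i in U) g i)%:E < nu (principal_minor A U))%E) ->
  (#|symdiff S T| <= 2)%N.
Proof.
move=> nubar hA hS hT hU; rewrite leqNgt; apply/negP => T3.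
have nz : principal_minor A S != 0.
  by apply/eqP => z; rewrite z valuation0 in hS.
have minorE U : (nu (principal_minor A S) + nu (principal_minor (pivot S A) U))%E =
    nu (principal_minor A (symdiff S U)).
  by rewrite -(principal_minor_pivot U nz); case: nuP => _ _ -> _.
have := minorE (symdiff S T); rewrite symdiffK hT hS.
rewrite -[in RHS](symdiffK S T) sum_symdiff.
suff : ((\sum_(i in symdiff S T) (if i \in S then - g i else g i))%:E <
    nu (principal_minor (pivot S A) (symdiff S T)))%E.
  case: (nu _) => [r||] //.
  by rewrite -EFinD lte_fin addrA => /[swap] -[] /addrI <-; rewrite ltxx.
apply: lt_valuation_principal_minor => // [|U U0 UT].
  exact: pivot_valuation_sym hA nz.
have US : symdiff S U != S.
  apply: contraNneq U0 => /(congr1 (symdiff S)).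
  by rewrite symdiffK -{2}(symdiff0 S) symdiffK => ->.
have {}UT : symdiff S U != T.
  by apply: contraNneq UT => <-; rewrite symdiffK.
have := hU _ US UT; rewrite -minorE sum_symdiff hS.
case: (nu _) => [r|_|]; last by rewrite addeNy ltNge leNye.
  by rewrite -EFinD !lte_fin addrA ltrD2l.
by rewrite ltry.
Qed.

End Valuation.

(** * Faces of convex hulls and edges of 0/1 polytopes *)

Section Convexity.
Context (R : realType).
Implicit Types n m : nat.

Lemma dotrv_sum n m (c : 'rV[R]_n) (w : 'I_m -> R) (y : 'I_m -> 'rV[R]_n) :
  dotrv c (\sum_i w i *: y i) = \sum_i w i * dotrv c (y i).
Proof.
rewrite /dotrv; under [RHS]eq_bigr do rewrite mulr_sumr.
rewrite exchange_big; apply: eq_bigr => j _ /=.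
by rewrite summxE mulr_sumr; apply: eq_bigr => i _; rewrite mxE mulrCA.
Qed.

Lemma sub_conv n (X : set 'rV[R]_n) : X `<=` conv X.
Proof.
move=> x Xx; exists 1%N, (fun=> 1), (fun=> x); split => //.
- by rewrite big_ord1.
- by rewrite big_ord1 scale1r.
Qed.

Lemma weights_pos m (w : 'I_m -> R) :
  (forall i, 0 <= w i) -> \sum_i w i = 1 -> exists i, 0 < w i.
Proof.
move=> w0 w1; apply/existsP; apply: contraPT w1 => /existsPn wn.
rewrite big1 => [|i _]; first by apply/eqP; rewrite eq_sym oner_eq0.
by apply/eqP; have := wn i; rewrite lt_neqAle w0 andbT negbK eq_sym.
Qed.

Lemma weights_const m (w : 'I_m -> R) a : \sum_i w i = 1 -> \sum_i w i * a = a.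
Proof. by move=> w1; rewrite -mulr_suml w1 mul1r. Qed.

(** If a convex combination attains the minimum, so does each of its points of nonzero weight. *)
Lemma face_conv n (X : set 'rV[R]_n) (c : 'rV[R]_n) :
  face_of_normal (conv X) c =
  conv [set x | X x /\ forall y, X y -> dotrv c x <= dotrv c y].
Proof.
apply/seteqP; split => x.
- case=> -[m [w [y [w0 w1 Xy xE]]]] xmin.
  have [i0 wi0] := weights_pos w0 w1.
  have yge i : dotrv c x <= dotrv c (y i) by apply: xmin; apply: sub_conv.
  have ymin i : w i != 0 -> dotrv c (y i) = dotrv c x.
    move=> wi; have : w i * (dotrv c (y i) - dotrv c x) = 0.
      have h : \sum_i w i * (dotrv c (y i) - dotrv c x) = 0.
        under eq_bigr do rewrite mulrBr.
        by rewrite sumrB weights_const // {1}xE dotrv_sum subrr.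
      by apply: (psumr_eq0P _ h) => // j _; rewrite mulr_ge0 // subr_ge0.
    by move/eqP; rewrite mulf_eq0 (negbTE wi) subr_eq0 => /eqP.
  (* Points of weight zero may fail to be minimal; they are replaced by [y i0], which has positive
     weight. *)
  exists m, w, (fun i => if w i == 0 then y i0 else y i); split => //.
  + move=> i; split; first by case: ifP.
    move=> z Xz; apply: le_trans (xmin z (sub_conv Xz)).
    by case: ifPn => wi; rewrite ymin // gt_eqF.
  + rewrite xE; apply: eq_bigr => i _.
    by case: eqP => // ->; rewrite !scale0r.
- move=> [m [w [y [w0 w1 Xy ->]]]]; split.
    by exists m, w, y; split => // i; case: (Xy i).
  move=> _ [m' [w' [z [w'0 w'1 Xz ->]]]]; rewrite !dotrv_sum.
  rewrite -[leLHS](weights_const _ w'1); apply: ler_sum => j _.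
  rewrite ler_wpM2l // -[leRHS](weights_const _ w1); apply: ler_sum => i _.
  by rewrite ler_wpM2l //; apply: (Xy i).2.
Qed.

Lemma conv_image_lsubmx n k (X : set 'rV[R]_(n + k)) :
  lsubmx @` conv X = conv (lsubmx @` X).
Proof.
apply/seteqP; split => x.
- case=> _ [m [w [y [w0 w1 Xy ->]]]] <-.
  exists m, w, (fun i => lsubmx (y i)); split => //.
  + by move=> i; exists (y i).
  + by rewrite linear_sum; apply: eq_bigr => i _; rewrite linearZ.
- case=> m [w [y [w0 w1 Xy ->]]].
  have {}Xy i : exists z, X z /\ lsubmx z = y i by have [z] := Xy i; exists z.
  have {Xy}[z hz] := choice Xy.
  exists (\sum_i w i *: z i).
    by exists m, w, z; split => // i; case: (hz i).
  by rewrite linear_sum; apply: eq_bigr => i _; rewrite linearZ /=; case: (hz i) => _ ->.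
Qed.

Lemma conv_pair n (u v x : 'rV[R]_n) : conv [set u; v] x ->
  exists2 t, 0 <= t & x = u + t *: (v - u).
Proof.
case=> m [w [y [w0 w1 Xy ->]]].
(* The parameter is the total weight placed on [v]. *)
exists (\sum_i w i * (y i == v)%:R).
  by apply: sumr_ge0 => i _; rewrite mulr_ge0.
have {1}-> : u = \sum_i w i *: u by rewrite -scaler_suml w1 scale1r.
rewrite scaler_suml -big_split /=.
apply: eq_bigr => i _; case: eqP => [->|ne].
  by rewrite mulr1 -scalerDr subrKC.
by rewrite mulr0 scale0r addr0; case: (Xy i) => [->|/ne].
Qed.

(** With points [u + t i *: (v - u)] and [t i] nonnegative, reaching [u] forces the weighted sum of
    the [t i] to vanish, so a point of positive weight is [u] itself. *)
Lemma conv_pair_extreme n (u v : 'rV[R]_n) (Y : set 'rV[R]_n) : u <> v ->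
  Y `<=` conv [set u; v] -> conv Y u -> Y u.
Proof.
move=> uv sY [m [w [y [w0 w1 Yy uE]]]].
have yE i : exists t, 0 <= t /\ y i = u + t *: (v - u).
  by have [t] := conv_pair (sY _ (Yy i)); exists t.
have {yE}[t /all_and2[t0 yE]] := choice yE.
have h : \sum_i w i * t i = 0.
  have : (\sum_i w i * t i) *: (v - u) = 0.
    apply: (@addrI _ u); rewrite addr0 [in RHS]uE.
    rewrite -[X in X + _]scale1r -w1 !scaler_suml -big_split /=.
    by apply: eq_bigr => i _; rewrite yE -scalerA -scalerDr.
  by move/eqP; rewrite scaler_eq0 subr_eq0 => /orP[/eqP//|/eqP/esym].
have [i wi] := weights_pos w0 w1.
have /eqP : w i * t i = 0.
  by apply: (psumr_eq0P _ h) => // j _; rewrite mulr_ge0.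
rewrite mulf_eq0 gt_eqF //= => /eqP ti.
by have := Yy i; rewrite yE ti scale0r addr0.
Qed.

Lemma indicator_inj n : injective (@indicator R n).
Proof.
move=> S T /rowP h; apply/setP => i; have := h i; rewrite !mxE.
by case: (i \in S); case: (i \in T) => //= /eqP; rewrite ?oner_eq0 // eq_sym oner_eq0.
Qed.

(** At a coordinate where [S] and [T] differ, the 0/1 value of [U] forces the parameter to be 0 or
    1. *)
Lemma indicator_conv_pair n (S T U : {set 'I_n}) :
  conv [set indicator R S; indicator R T] (indicator R U) -> U = S \/ U = T.
Proof.
case/conv_pair => t _ UE.
have [STe|ST] := eqVneq S T.
  by left; apply: indicator_inj; rewrite UE STe subrr scaler0 addr0.
have [i] : exists i, (i \in S) != (i \in T).
  apply/existsP; apply: contraNT ST => /existsPn h; apply/eqP/setP => i.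
  by apply/eqP; have := h i; rewrite negbK.
have tE : (i \in U)%:R = (i \in S)%:R + t * ((i \in T)%:R - (i \in S)%:R).
  by have /rowP/(_ i) := UE; rewrite !mxE.
move=> iST; have {iST tE} : t = 0 \/ t = 1.
  move: iST tE; case: (i \in U); case: (i \in S); case: (i \in T) => //= _ ?;
  by [left; lra|right; lra].
case=> t01; [left|right]; apply: indicator_inj; rewrite UE t01.
  by rewrite scale0r addr0.
by rewrite scale1r subrKC.
Qed.

Lemma hamming_indicator n (S T : {set 'I_n}) :
  hamming (indicator R S) (indicator R T) = #|symdiff S T|.
Proof.
apply: eq_card => i; rewrite !inE !mxE.
by case: (i \in S); case: (i \in T); rewrite //= ?eqxx // ?oner_eq0 // eq_sym oner_eq0.
Qed.

Lemma dotrv_indicator n (c : 'rV[R]_n) (S : {set 'I_n}) :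
  dotrv c (indicator R S) = \sum_(i in S) c ord0 i.
Proof.
rewrite /dotrv [RHS]big_mkcond; apply: eq_bigr => i _; rewrite mxE.
by case: ifP; rewrite ?mulr1 ?mulr0.
Qed.

Lemma small_perturbation (I : finType) (a b : I -> R) :
  exists2 e, 0 < e & forall i, 0 < a i -> 0 < a i + e * b i.
Proof.
(* [E] exceeds every ratio of absolute values, so [e = E^-1] keeps [e * b i] smaller in size than a
   positive [a i]. *)
pose E := 1 + \sum_i `|b i / a i|.
have E0 : 0 < E by rewrite ltr_pwDl // sumr_ge0.
exists E^-1; first by rewrite invr_gt0.
move=> i ai; have : `|b i / a i| < E.
  rewrite /E (bigD1 i) //= addrCA ltrDl ltr_pwDl // sumr_ge0 //.
rewrite normrM normfV (gtr0_norm ai) ltr_pdivrMr // => h.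
have : - b i < E * a i by apply: le_lt_trans h; rewrite -normrN ler_norm.
rewrite -subr_gt0 opprK => h'.
have -> : a i + E^-1 * b i = E^-1 * (E * a i + b i) by field; rewrite gt_eqF.
by rewrite mulr_gt0 // invr_gt0.
Qed.

(** Extremality makes [u] and [v] minimisers of [d], hence indicators; a third minimiser would be an
    indicator on the segment between them. *)
Lemma edge_conv_indicator n (M : set {set 'I_n}) u v :
  edge (conv (@indicator R n @` M)) u v ->
  exists S T (d : 'I_n -> R),
  [/\ u = indicator R S, v = indicator R T, M S, M T &
      \sum_(i in S) d i = \sum_(i in T) d i /\
      forall U, M U -> U <> S -> U <> T -> \sum_(i in S) d i < \sum_(i in U) d i].
Proof.
case=> uv [d]; rewrite face_conv; set Y := [set x | _] => e.
have sY : Y `<=` conv [set u; v] by rewrite e; apply: sub_conv.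
have Yu : Y u.
  by apply: (conv_pair_extreme uv sY); rewrite -e; apply: sub_conv; left.
have Yv : Y v.
  apply: (conv_pair_extreme (nesym uv)); first by rewrite setUC.
  by rewrite -e; apply: sub_conv; right.
have [[S MS uE] umin] := Yu; have [[T MT vE] vmin] := Yv.
exists S, T, (d ord0); split => //.
rewrite -!dotrv_indicator uE vE; split.
  by apply/le_anti; rewrite umin ?vmin //; [exists S|exists T].
move=> U MU US UT; rewrite -dotrv_indicator ltNge; apply/negP => le_US.
have : conv [set u; v] (indicator R U).
  apply: sY; split; first by exists U.
  by move=> y My; apply: le_trans le_US _; apply: umin.
by rewrite -uE -vE => /indicator_conv_pair [].
Qed.

End Convexity.

(** * From edges of cells to pairs of minimisers *)

(** A normal [c] cuts out the cell and [d] an edge of it; adding a small multiple of [d] to [c]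
    isolates the two endpoints among all lifted points. *)
Lemma valuated_delta_matroid_criterion (R : realType) n (p : {set 'I_n} -> \bar R) :
  (forall S, p S <> -oo%E) ->
  (forall (g : 'I_n -> R) (k : R) (S T : {set 'I_n}),
     p S = (k + \sum_(i in S) g i)%:E -> p T = (k + \sum_(i in T) g i)%:E ->
     (forall U : {set 'I_n}, U != S -> U != T ->
        ((k + \sum_(i in U) g i)%:E < p U)%E) ->
     (#|symdiff S T| <= 2)%N) ->
  valuated_delta_matroid p.
Proof.
move=> pN hp; split => // _ [_ [c cl ->] <-].
rewrite face_conv conv_image_lsubmx; set Y := lsubmx @` _.
pose cn := c ord0 (rshift n ord0).
pose a (S : {set 'I_n}) := \sum_(i in S) c ord0 (lshift 1 i) + cn * fine (p S).
have aE S : dotrv c (row_mx (indicator R S) (fine (p S))%:M) = a S.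
  rewrite /dotrv big_split_ord /= big_ord1 row_mxEr mxE eqxx mulr1n; congr (_ + _).
  rewrite [RHS]big_mkcond; apply: eq_bigr => i _; rewrite row_mxEl mxE.
  by case: ifP; rewrite ?mulr1 ?mulr0.
pose M := [set S | dom p S /\ forall U, dom p U -> a S <= a U].
have YE : Y = @indicator R n @` M.
  apply/seteqP; split => x.
    case=> _ [[S pS <-] Smin] <-; exists S; last by rewrite row_mxKl.
    by split=> // U pU; rewrite -!aE; apply: Smin; exists U.
  case=> S [pS Smin] <-.
  exists (row_mx (indicator R S) (fine (p S))%:M); last by rewrite row_mxKl.
  by split; [exists S|move=> _ [U pU <-]; rewrite !aE; apply: Smin].
rewrite YE; split.
- exists (@indicator R n @` M) => //; apply: finite_image.
  exact: finite_finset.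
- move=> v [d]; rewrite face_conv => e.
  (* The hull of the minimisers is [[set v]]; it is nonempty, so some minimiser exists and equals
     [v]. *)
  have /seteqP[+ _] := e => /(_ v erefl)[m [w [y [w0 w1 Xy _]]]].
  have [i _] := weights_pos w0 w1.
  have /seteqP[_ /(_ _ (sub_conv (Xy i))) <-] := e.
  by have [[S _ <-] _] := Xy i; exists S.
move=> u v /edge_conv_indicator[S [T [d [-> -> [pS Smin] [pT Tmin] [dST dU]]]]].
rewrite hamming_indicator.
have [e e0 he] := small_perturbation (fun U => a U - a S)
  (fun U => \sum_(i in U) d i - \sum_(i in S) d i).
(* Solving [a U + e * d(U) = a S + e * d(S)] for [fine (p U)] gives [k] plus the sum of [g] over
   [U]. *)
pose k := (a S + e * \sum_(i in S) d i) / cn.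
pose g i := - (c ord0 (lshift 1 i) + e * d i) / cn.
have gE (U : {set 'I_n}) : \sum_(i in U) g i =
    - (\sum_(i in U) c ord0 (lshift 1 i) + e * \sum_(i in U) d i) / cn.
  by rewrite -mulr_suml sumrN big_split /= mulr_sumr.
have finE U : dom p U -> p U = (fine (p U))%:E.
  by rewrite /dom /=; have := pN U; case: (p U).
have cn0 : cn != 0 by rewrite gt_eqF.
have aST : a S = a T by apply/le_anti; rewrite Smin // Tmin.
have fineE U : fine (p U) = (a U + e * \sum_(i in U) d i) / cn + \sum_(i in U) g i.
  by rewrite gE /a; field.
apply: (hp g k).
- by rewrite finE //; congr EFin; rewrite fineE.
- by rewrite finE //; congr EFin; rewrite fineE -dST -aST.
move=> U US UT; have [pU|] := pselect (dom p U); last first.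
  by move=> /contrapT ->; rewrite ltry.
rewrite finE // lte_fin fineE ltrD2r /k ltr_pM2r ?invr_gt0 //.
(* Off the cell the gap in [a] dominates the perturbation; on the cell [a] ties and [d] decides. *)
have [lt_a|] := ltP (a S) (a U).
  by have := he U; rewrite subr_gt0 => /(_ lt_a); rewrite mulrBr; lra.
move=> le_a; have MU : M U.
  by split => // V pV; apply: le_trans le_a _; apply: Smin.
have -> : a U = a S by apply/le_anti; rewrite le_a Smin.
by rewrite ltrD2l ltr_pM2l //; apply: dU => //; apply/eqP.
Qed.

Theorem theorem6p1 (R : realType) (K : fieldType) (nu : K -> \bar R)
  (bar : {rmorphism K -> K}) (n : nat) (A : 'M[K]_n) :
  nonarch_valuation nu ->
  involutive bar ->
  (forall a : K, nu (bar a) = nu a) ->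
  is_hermitian bar A \/ is_skew_hermitian bar A ->
  valuated_delta_matroid (fun S : {set 'I_n} => nu (principal_minor A S)).
Proof.
move=> nuP _ nubar hA; apply: valuated_delta_matroid_criterion => [S|g k S T].
  by case: nuP => nuN _ _ _; apply: nuN.
exact: (two_minimal_minors nuP nubar hA).
Qed.
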